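(* Let $s$ be a positive integer and $\alpha=[\alpha_1,\dots,\alpha_m]$ a composition. Then \[ F^\perp_s \mathfrak{S}_\alpha = \sum_{\gamma\models |\alpha|-s} c_{s,\alpha}^\gamma\, \mathfrak{S}_{\gamma}, \] where the sum is over compositions $\gamma$ of $|\alpha|-s$ and \[ c_{s,\alpha}^\gamma=\begin{cases} \mathrm{sgn}(\alpha-\gamma) & \text{if } \ell(\gamma)=\ell(\alpha) \text{ and } \alpha-\gamma \text{ satisfies (Z1)--(Z3)},\\ \mathrm{sgn}(\alpha_1-\gamma_1,\ldots,\alpha_{k-1}-\gamma_{k-1}) & \text{if } \ell(\gamma)=\ell(\alpha)-1,\ r-k \text{ is even, and } (\alpha_1-\gamma_1,\ldots,\alpha_{k-1}-\gamma_{k-1},\alpha_k,0,\ldots,0)\\ & \text{ satisfies (Z1)--(Z3)},\\ 0 & \text{otherwise}. \end{cases} \] Here, when $\ell(\gamma)=\ell(\alpha)-1$, $k$ is the smallest integer $1\le k\le m$ such that $\alpha_i=\gamma_{i-1}$ for all $k<i\le m$, and $r$ is the largest integer $k\le r\le m$ such that $\alpha_k<\alpha_{k+1}<\cdots<\alpha_r$. In particular every coefficient $c^\gamma_{s,\alpha}$ lies in $\{-1,0,1\}$, and $c^\gamma_{s,\alpha}=0$ unless $\ell(\gamma)\in\{\ell(\alpha),\ell(\alpha)-1\}$.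
   Context: $\operatorname{NSym}$ is the free associative algebra over $\mathbb{Q}$ on generators $H_1,H_2,\dots$ ($H_i$ of degree $i$), $H_0=1$, $H_{-r}=0$ for $r>0$. $\operatorname{QSym}$ is the algebra of quasi-symmetric functions, dual to $\operatorname{NSym}$ via $\langle H_\alpha,M_\beta\rangle=\delta_{\alpha,\beta}$ ($M_\beta$ monomial quasi-symmetric functions). $F_\alpha=\sum_{\beta\le\alpha}M_\beta$ (sum over refinements) is the fundamental basis; $F_s$ is indexed by $[s]$, $F_{1^i}$ by $i$ ones, $F_0=1$. For $F\in\operatorname{QSym}$, $F^\perp$ on $\operatorname{NSym}$ is defined by $\langle F^\perp H,G\rangle=\langle H,FG\rangle$ for all $G\in\operatorname{QSym}$. $H^L_m$ is left multiplication by $H_m$; $\mathbb{B}_m=\sum_{i\ge0}(-1)^iH^L_{m+i}F^\perp_{1^i}$ for $m\in\mathbb{Z}$; the immaculate functions are $\mathfrak{S}_\alpha=\mathbb{B}_{\alpha_1}\cdots\mathbb{B}_{\alpha_m}(1)$, which for compositions $\alpha$ form a basis of $\operatorname{NSym}$. For $\beta\in\mathbb{Z}^p$, $\mathrm{sgn}(\beta)=(-1)^{\mathrm{neg}(\beta)}$ where $\mathrm{neg}(\beta)$ is the number of negative entries of $\beta$; $\alpha-\gamma$ denotes the entrywise difference. A vector $\beta=(\beta_1,\dots,\beta_m)\in\mathbb{Z}^m$ satisfies (Z1)--(Z3) (relative to $s$ and $\alpha$) if: (Z1) $\beta_1+\dots+\beta_m=s$ and $\beta_1+\dots+\beta_i\le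 s$ for $i<m$; (Z2) $\alpha_i-\beta_i\ge0$ for all $i$, and $\alpha_i-\beta_i=0$ for at most one $i$; (Z3) for each $i$, writing $t_i=s-(\beta_1+\dots+\beta_{i-1})$: (a) if $\alpha_i>t_i$ then $0\le\beta_i\le t_i$; (b) if $\alpha_i=t_i$ then either $\beta_i=\alpha_i$ and $\beta_{i+1}=\dots=\beta_m=0$, or $\beta_i<0$; (c) if $\alpha_i<t_i$ then $\beta_i<0$. *)

(* Defs.v *)
From HB Require Import structures.
From mathcomp Require Import all_boot all_order all_algebra finmap.
From mathcomp Require Import monalg.

Set Implicit Arguments.
Unset Strict Implicit.
Unset Printing Implicit Defensive.

Import Order.TTheory GRing.Theory Num.Theory.
Local Open Scope ring_scope.

(* Under concatenation, the free monoid on the positive integers. *)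
Record composition : predArgType := Composition {
  parts :> seq nat;
  _ : all (ltn 0%N) parts
}.

HB.instance Definition _ := [isSub for parts].
HB.instance Definition _ := [Choice of composition by <:].

Lemma comp_pos (a : composition) : all (ltn 0%N) a.
Proof. exact: valP. Qed.

Definition comp_nil : composition := @Composition [::] isT.

Lemma comp_cat_proof (a b : composition) : all (ltn 0%N) (a ++ b).
Proof. by rewrite all_cat !comp_pos. Qed.

Definition comp_cat (a b : composition) : composition :=
  Composition (comp_cat_proof a b).

Lemma comp_catA : associative comp_cat.
Proof. by move=> a b c; apply/val_inj/catA. Qed.

Lemma comp_cat0l : left_id comp_nil comp_cat.
Proof. by move=> a; apply/val_inj. Qed.

Lemma comp_cat0r : right_id comp_nil comp_cat.
Proof. by move=> a; apply/val_inj/cats0. Qed.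

Lemma comp_cat_eq0 (a b : composition) :
  comp_cat a b = comp_nil -> a = comp_nil /\ b = comp_nil.
Proof.
by case: a b => [[|x a] pa] [[|y b] pb] // _; split; apply/val_inj.
Qed.

HB.instance Definition _ := Choice_isMonomialDef.Build composition
  comp_catA comp_cat0l comp_cat0r comp_cat_eq0.

(* Deletes the zero parts; pack [:: 0] is the empty composition. *)
Definition pack (e : seq nat) : composition :=
  Composition (filter_all (ltn 0%N) e).

Lemma packK (a : composition) : pack a = a.
Proof. by apply/val_inj/all_filterP/comp_pos. Qed.

Lemma sumn_pack e : sumn (pack e) = sumn e.
Proof. by elim: e => //= -[|n] e /= ->. Qed.

Fixpoint comp_seqs (fuel n : nat) : seq (seq nat) :=
  if n is 0 then [:: [::]]
  else if fuel is f.+1 then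
    [seq i :: c | i <- iota 1 n, c <- comp_seqs f (n - i)]
  else [::].

Lemma mem_comp_seqs f n c : (n <= f)%N ->
  (c \in comp_seqs f n) = all (ltn 0%N) c && (sumn c == n).
Proof.
have comp0 d : (d \in [:: [::]]) = all (ltn 0%N) d && (sumn d == 0%N).
  by case: d => [|[|x] d] //=; rewrite inE; case: (all _ _).
elim: f n c => [|f IH] [|n] c le_nf //.
apply/flatten_mapP/idP => [[i + /mapP[d + ->]]|].
  rewrite mem_iota => /andP[i0 lei]; rewrite IH; last first.
    by case: i i0 {lei} => // i _; rewrite subSS (leq_trans (leq_subr _ _)).
  by move=> /andP[pd /eqP sd] /=; rewrite i0 pd /= sd subnKC.
case: c => [|i d] //; case/andP=> /andP[i0 pd] /eqP; rewrite [sumn _]/= => sd.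
exists i; first by rewrite mem_iota add1n ltnS -sd leq_addr andbT.
apply/mapP; exists d => //.
have le_df : (n.+1 - i <= f)%N.
  rewrite -sd addKn -ltnS; apply: leq_trans le_nf; rewrite -sd.
  by rewrite -[X in (X < _)%N]add0n ltn_add2r.
by rewrite IH // -sd addKn eqxx andbT.
Qed.

Lemma uniq_comp_seqs f n : uniq (comp_seqs f n).
Proof.
elim: f n => [|f IH] [|n] //; apply: allpairs_uniq_dep => //.
- exact: iota_uniq.
- by move=> [i c] [j d] _ _ /= [-> ->].
Qed.

Definition comps (n : nat) : seq composition := pmap insub (comp_seqs n n).

Lemma mem_comps n (c : composition) : (c \in comps n) = (sumn c == n).
Proof. by rewrite mem_pmap_sub mem_comp_seqs // comp_pos. Qed.

Lemma uniq_comps n : uniq (comps n).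
Proof. exact/pmap_sub_uniq/uniq_comp_seqs. Qed.

(* There are no compositions of a negative integer. *)
Definition compsz (z : int) : seq composition :=
  if z is Posz n then comps n else [::].

Lemma mem_compsz z (c : composition) : (c \in compsz z) = ((sumn c)%:Z == z).
Proof. by case: z => n //=; rewrite mem_comps. Qed.

Fixpoint coarsenings (b : seq nat) : seq (seq nat) :=
  if b is x :: b' then
    flatten [seq (x :: c) ::
                 (if c is y :: c' then [:: (x + y)%N :: c'] else [::])
            | c <- coarsenings b']
  else [:: [::]].

Definition refines (b a : seq nat) : bool := a \in coarsenings b.

Lemma refinesP (b a : seq nat) :
  reflect (exists bs : seq (seq nat),
             [/\ [::] \notin bs, flatten bs = b & map sumn bs = a])
          (refines b a).
Proof.
rewrite /refines; apply: (iffP idP).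
  elim: b a => [|x b IH] a /=.
    by rewrite inE => /eqP->; exists [::].
  case/flatten_mapP=> c /IH[bs [bs0 fbs sbs]]; rewrite inE => /orP[/eqP->|].
    by exists ([:: x] :: bs); rewrite inE /= bs0 fbs sbs addn0.
  case: bs bs0 fbs sbs => [|b1 bs] bs0 fbs <- //=; rewrite inE => /eqP->.
  exists ((x :: b1) :: bs); split=> //=; last by rewrite -fbs.
  by move: bs0; rewrite !inE => /norP[].
elim: b a => [|x b IH] a [bs [bs0 fbs <-]].
  by case: bs bs0 fbs => [|[|y b1] bs].
case: bs bs0 fbs => [|[|y b1] bs] //; rewrite inE /= => bs0 [-> fbs].
apply/flatten_mapP; case: b1 fbs => [|z b1] fbs.
  by exists (map sumn bs); rewrite ?inE ?addn0 ?eqxx //; apply: IH; exists bs.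
exists (map sumn ((z :: b1) :: bs)); last by rewrite !inE eqxx orbT.
by apply: IH; exists ((z :: b1) :: bs); rewrite inE.
Qed.

(* The monomial H_a of NSym is << a >>, with product concatenation. *)
Definition NSym := {malg rat[composition]}.
HB.instance Definition _ := GRing.Lalgebra.on NSym.

Definition Hgen (z : int) : NSym :=
  match z with
  | Posz 0 => 1
  | Posz n => << pack [:: n] >>
  | Negz _ => 0
  end.

Lemma Hgen_comp (a : composition) :
  (<< a >> : NSym) = \prod_(i <- parts a) Hgen (Posz i).
Proof.
case: a => a pa; rewrite /=; elim: a pa => [|[|n] a IH] //= pa.
  by rewrite big_nil; congr mkmalgU; apply/val_inj.
rewrite big_cons /= -(IH pa) malgM_def fgmulUU mulr1; congr mkmalgU.
exact/val_inj.
Qed.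

(* A bounded degree power series in x_1, x_2, ... is given by its coefficients:
   the list e stands for the monomial x_1^e_1 ... x_n^e_n.  Quasi-symmetry says
   that the coefficient only depends on the sequence of nonzero exponents. *)
Record QSym := MkQSym {
  qcoef :> seq nat -> rat;
  qcoef_pack : forall e, qcoef e = qcoef (pack e);
  qcoef_bounded : exists d, forall e, (d < sumn e)%N -> qcoef e = 0
}.

(* All the ways to write x^e as a product of two monomials. *)
Fixpoint splits (e : seq nat) : seq (seq nat * seq nat) :=
  if e is n :: e' then
    [seq (i :: p.1, (n - i)%N :: p.2) | i <- iota 0 n.+1, p <- splits e']
  else [:: ([::], [::])].

Lemma sumn_splits e p : p \in splits e -> (sumn p.1 + sumn p.2)%N = sumn e.
Proof.
elim: e p => [|n e IH] p.
  by rewrite inE => /eqP->.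
case/flatten_mapP=> i + /mapP[q /IH + ->] /=.
rewrite mem_iota add0n ltnS /= => le_in <-.
by rewrite addnACA subnKC.
Qed.

Definition ps_mul (f g : seq nat -> rat) (e : seq nat) : rat :=
  \sum_(p <- splits e) f p.1 * g p.2.

Lemma ps_mul_cons f g n e : ps_mul f g (n :: e) =
  \sum_(i <- iota 0 n.+1) ps_mul (f \o cons i) (g \o cons (n - i)%N) e.
Proof. by rewrite /ps_mul big_allpairs_dep. Qed.

Lemma ps_mul_pack f g :
  (forall e, f e = f (pack e)) -> (forall e, g e = g (pack e)) ->
  forall e, ps_mul f g e = ps_mul f g (pack e).
Proof.
have pack1 h i : (forall e, h e = h (pack e)) ->
    forall e, h (i :: e) = h (i :: pack e) :> rat.
  move=> hP e; rewrite hP [RHS]hP; congr h; rewrite /=.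
  by case: i => [|i] /=; rewrite filter_id.
move=> fP gP e; elim: e f g fP gP => [|n e IH] f g fP gP //.
have Q h i : (forall e, h e = h (pack e) :> rat) ->
    forall e, (h \o cons i) e = (h \o cons i) (pack e).
  by move=> hP e'; apply: pack1.
rewrite ps_mul_cons; case: n => [|n]; last first.
  rewrite [pack _]/= ps_mul_cons.
  by apply: eq_bigr => i _; apply: IH; apply: Q.
rewrite big_seq1 subnn -[parts (pack (0 :: e))]/(parts (pack e)) -IH //.
apply: eq_bigr => p _ /=; congr (_ * _); first by rewrite fP [RHS]fP.
by rewrite gP [RHS]gP.
Qed.

Lemma qmul_pack (f g : QSym) e : ps_mul f g e = ps_mul f g (pack e).
Proof. by apply: ps_mul_pack => ?; apply: qcoef_pack. Qed.

Lemma qmul_bounded (f g : QSym) :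
  exists d, forall e, (d < sumn e)%N -> ps_mul f g e = 0.
Proof.
have [[d1 h1] [d2 h2]] := (qcoef_bounded f, qcoef_bounded g).
exists (d1 + d2)%N => e lt_e.
rewrite /ps_mul big_seq big1 // => p /sumn_splits sp.
have [le1|lt1] := leqP (sumn p.1) d1; last by rewrite h1 ?mul0r.
rewrite h2 ?mulr0 //; rewrite -sp in lt_e.
by rewrite -(ltn_add2l d1) (leq_trans lt_e) // leq_add2r.
Qed.

Definition qmul (f g : QSym) : QSym :=
  MkQSym (qmul_pack f g) (qmul_bounded f g).

Lemma qadd_pack (f g : QSym) e : f e + g e = f (pack e) + g (pack e).
Proof. by rewrite qcoef_pack [g e]qcoef_pack. Qed.

Lemma qadd_bounded (f g : QSym) :
  exists d, forall e, (d < sumn e)%N -> f e + g e = 0.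
Proof.
have [[d1 h1] [d2 h2]] := (qcoef_bounded f, qcoef_bounded g).
exists (maxn d1 d2) => e; rewrite gtn_max => /andP[? ?].
by rewrite h1 ?h2 ?addr0.
Qed.

Definition qadd (f g : QSym) : QSym :=
  @MkQSym (fun e => f e + g e) (qadd_pack f g) (qadd_bounded f g).

Lemma qzero_bounded :
  exists d, forall e : seq nat, (d < sumn e)%N -> 0 = 0 :> rat.
Proof. by exists 0. Qed.

Definition qzero : QSym := @MkQSym (fun=> 0) (fun=> erefl) qzero_bounded.

(* The sum of x_{i_1}^{b_1} ... x_{i_k}^{b_k} over i_1 < ... < i_k, i.e., of the
   monomials whose sequence of nonzero exponents is b. *)
Definition Mcoef (b : composition) (e : seq nat) : rat := (pack e == b)%:R.

Lemma Mqs_pack b e : Mcoef b e = Mcoef b (pack e).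
Proof. by rewrite /Mcoef packK. Qed.

Lemma Mqs_bounded b : exists d, forall e, (d < sumn e)%N -> Mcoef b e = 0.
Proof.
exists (sumn b) => e; rewrite /Mcoef; case: eqP => // <-.
by rewrite sumn_pack ltnn.
Qed.

Definition Mqs (b : composition) : QSym :=
  MkQSym (@Mqs_pack b) (@Mqs_bounded b).

Definition Fqs (a : composition) : QSym :=
  \big[qadd/qzero]_(b <- comps (sumn a) | refines b a) Mqs b.

Lemma FqsE (a : composition) e :
  Fqs a e = \sum_(b <- comps (sumn a) | refines b a) Mqs b e.
Proof. exact: (big_morph (fun f : QSym => f e)). Qed.

Lemma Fqs_homog (a : composition) e : sumn e != sumn a -> Fqs a e = 0.
Proof.
move=> neq; rewrite FqsE big_seq_cond big1 // => b /andP[+ _].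
rewrite mem_comps => /eqP sb; rewrite /= /Mcoef.
by case: eqP => // eb; rewrite -sb -eb sumn_pack eqxx in neq.
Qed.

(* The pairing with <H_a, M_b> = 1 if a = b and 0 otherwise; the coefficient of
   M_a in g is g a. *)
Definition pairing (X : NSym) (g : QSym) : rat :=
  \sum_(a <- msupp X) X@_a * g a.

Lemma pairing_HM (a b : composition) : pairing << a >> (Mqs b) = (a == b)%:R.
Proof.
by rewrite /pairing msuppU1 big_seq_fset1 mcoeffUU mul1r /= /Mcoef packK.
Qed.

Lemma pairing_M (X : NSym) (b : composition) : pairing X (Mqs b) = X@_b.
Proof.
rewrite /pairing; under eq_bigr => a _ do rewrite /= /Mcoef packK.
have [bX|bX] := boolP (b \in msupp X).
  rewrite (big_fsetD1 b) //= eqxx mulr1 big1_fset ?addr0 // => a.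
  by rewrite !inE => /andP[/negbTE-> _] _; rewrite mulr0.
rewrite (mcoeff_outdom bX) big1_fset // => a aX _.
by case: eqP => [ab|_]; rewrite ?mulr0 // -ab aX in bX *.
Qed.

Definition hdeg (X : NSym) : nat := \max_(a <- msupp X) sumn (parts a).

Lemma hdeg_le X a : a \in msupp X -> (sumn (parts a) <= hdeg X)%N.
Proof. by move=> aX; rewrite /hdeg (big_fsetD1 a) //= leq_maxl. Qed.

(* The adjoint of multiplication by F, by its coordinates on the basis H_b;
   perpP and perp_unique below characterize it. *)
Definition perp (F : QSym) (X : NSym) : NSym :=
  \sum_(n < (hdeg X).+1) \sum_(b <- comps n)
    pairing X (qmul F (Mqs b)) *: (<< b >> : NSym).

Lemma pairing_addl (X Y : NSym) g :
  pairing (X + Y) g = pairing X g + pairing Y g.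
Proof.
have w (d : {fset composition}) (Z : NSym) : (msupp Z `<=` d)%fset ->
    pairing Z g = \sum_(a <- d) Z@_a * g a.
  move=> sd; apply: big_fset_incl => // a _ aZ.
  by rewrite (mcoeff_outdom aZ) mul0r.
rewrite (w (msupp X `|` msupp Y)%fset X) ?fsubsetUl //.
rewrite (w (msupp X `|` msupp Y)%fset Y) ?fsubsetUr //.
rewrite (w (msupp X `|` msupp Y)%fset (X + Y)) ?msuppD_le //.
by rewrite -big_split; apply: eq_bigr => a _; rewrite mcoeffD mulrDl.
Qed.

Lemma pairing0l g : pairing 0 g = 0.
Proof. by rewrite /pairing msupp0 big_seq_fset0. Qed.

Lemma pairing_ZU c b g : pairing (c *: (<< b >> : NSym)) g = c * g b.
Proof.
have -> : c *: (<< b >> : NSym) = << c *g b >>.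
  by apply/malgP => k; rewrite mcoeffZ !mcoeffU mulrnAr mulr1.
rewrite /pairing msuppU; case: eqP => [->|_].
  by rewrite big_seq_fset0 mul0r.
by rewrite big_seq_fset1 mcoeffUU.
Qed.

Lemma pairing_suml I (r : seq I) (P : pred I) (X : I -> NSym) g :
  pairing (\sum_(i <- r | P i) X i) g = \sum_(i <- r | P i) pairing (X i) g.
Proof.
exact: (big_morph (pairing^~ g) (fun x y => pairing_addl x y g) (pairing0l g)).
Qed.

Lemma perpP (F : QSym) (X : NSym) (G : QSym) :
  pairing (perp F X) G = pairing X (qmul F G).
Proof.
rewrite pairing_suml.
under eq_bigr => n _.
  rewrite pairing_suml; under eq_bigr => b _.
    by rewrite pairing_ZU mulr_suml; over.
  rewrite exchange_big; over.
rewrite exchange_big; apply: eq_big_seq => a aX /=.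
under eq_bigr => n _.
  under eq_bigr => b _.
    rewrite -mulrA /ps_mul mulr_suml; over.
  rewrite -mulr_sumr exchange_big; over.
rewrite -mulr_sumr; congr (_ * _).
rewrite exchange_big; apply: eq_big_seq => p ap /=.
have le_p : (sumn p.2 < (hdeg X).+1)%N.
  by rewrite ltnS (leq_trans _ (hdeg_le aX)) // -(sumn_splits ap) leq_addl.
have cn n : \sum_(b <- comps n) F p.1 * Mcoef b p.2 * G b
    = (n == sumn p.2)%:R * (F p.1 * G p.2).
  case: eqP => [->|neq].
    rewrite mul1r (bigD1_seq (pack p.2)) ?uniq_comps ?mem_comps ?sumn_pack //=.
    rewrite {1}/Mcoef eqxx mulr1 -qcoef_pack big1 ?addr0 // => b.
    by rewrite /Mcoef eq_sym => /negbTE->; rewrite mulr0 mul0r.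
  rewrite mul0r big_seq big1 // => b; rewrite mem_comps => /eqP sb.
  rewrite /Mcoef; case: eqP => [eb|_]; last by rewrite mulr0 mul0r.
  by case: neq; rewrite -sb -eb sumn_pack.
under eq_bigr => n _ do rewrite cn.
rewrite (bigD1 (Ordinal le_p)) //= eqxx mul1r big1 ?addr0 // => n.
by rewrite -val_eqE /= => /negbTE->; rewrite mul0r.
Qed.

Lemma perp_unique (F : QSym) (X Y : NSym) :
  (forall G, pairing Y G = pairing X (qmul F G)) -> Y = perp F X.
Proof.
move=> YP; apply/malgP => b.
by rewrite -!pairing_M YP perpP.
Qed.

Lemma perp_Fqs_eq0 (a : composition) X :
  (hdeg X < sumn a)%N -> perp (Fqs a) X = 0.
Proof.
move=> lt_Xa; apply/esym/perp_unique => G.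
rewrite pairing0l /pairing big_seq big1 // => b /hdeg_le le_b /=.
rewrite /ps_mul big_seq big1 ?mulr0 // => p /sumn_splits sp.
rewrite Fqs_homog ?mul0r // neq_ltn; apply/orP; left.
by apply: leq_ltn_trans lt_Xa; apply: leq_trans le_b; rewrite -sp leq_addr.
Qed.

(* The terms with i > hdeg X of the sum over all i >= 0 vanish, see BopE. *)
Definition Bop (m : int) (X : NSym) : NSym :=
  \sum_(i < (hdeg X).+1)
    (-1) ^+ i *: (Hgen (m + i%:Z) * perp (Fqs (pack (nseq i 1%N))) X).

Lemma BopE (N : nat) m X : (hdeg X < N)%N ->
  Bop m X = \sum_(i < N)
    (-1) ^+ i *: (Hgen (m + i%:Z) * perp (Fqs (pack (nseq i 1%N))) X).
Proof.
move=> lt_XN; rewrite /Bop.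
pose T i := (-1) ^+ i *: (Hgen (m + i%:Z) * perp (Fqs (pack (nseq i 1%N))) X).
rewrite -(big_mkord predT T) -(big_mkord predT T).
rewrite [RHS](big_cat_nat _ lt_XN) //= [X in _ + X]big_nat_cond.
rewrite [X in _ + X]big1 ?addr0 // => i /andP[/andP[lt_Xi _] _].
by rewrite /T perp_Fqs_eq0 ?mulr0 ?scaler0 // sumn_pack sumn_nseq mul1n.
Qed.

Definition immaculate (a : seq int) : NSym := foldr Bop 1 a.

Definition ints (a : composition) : seq int := [seq i%:Z | i <- parts a].

Definition vsub (a b : seq int) : seq int := [seq p.1 - p.2 | p <- zip a b].

Definition sgnv (b : seq int) : rat := (-1) ^+ count (fun x => x < 0) b.

(* In Z1 and Z3 the indices start from 0, so that take i b is the list of the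
   entries before the one of index i; in kidx and ridx they start from 1. *)

Definition Z1 (s : nat) (b : seq int) : bool :=
  (\sum_(x <- b) x == s%:Z) &&
  [forall i : 'I_(size b), (0 < i)%N ==> (\sum_(x <- take i b) x <= s%:Z)].

Definition Z2 (a b : seq int) : bool :=
  all (fun x => 0 <= x) (vsub a b) && (count (pred1 0%R) (vsub a b) <= 1)%N.

Definition Z3 (s : nat) (a b : seq int) : bool :=
  [forall i : 'I_(size a),
    let ai := nth 0 a i in
    let bi := nth 0 b i in
    let ti := s%:Z - \sum_(x <- take i b) x in
    [&& (ai > ti) ==> (0 <= bi <= ti),
        (ai == ti) ==>
          ((bi == ai) && all (pred1 0) (drop i.+1 b)) || (bi < 0)
      & (ai < ti) ==> (bi < 0)]].

Definition Zcond (s : nat) (a b : seq int) : bool :=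
  [&& size b == size a, Z1 s b, Z2 a b & Z3 s a b].

(* The smallest 1 <= k <= m such that a_i = g_{i-1} for all k < i <= m, where
   m is the length of a; k = m qualifies as soon as m > 0. *)
Definition kidx (a g : seq int) : 'I_(size a).+1 :=
  [arg min_(k < ord_max : 'I_(size a).+1 |
     (0 < k) && [forall i : 'I_(size a).+1,
                   (k < i) ==> (nth 0%R a i.-1 == nth 0%R g i.-2)]) k]%N.

(* The largest k <= r <= m such that a_k < a_{k+1} < ... < a_r. *)
Definition ridx (a : seq int) (k : 'I_(size a).+1) : 'I_(size a).+1 :=
  [arg max_(r > k |
     (k <= r) && [forall j : 'I_(size a).+1,
                   (k <= j < r) ==> (nth 0 a j.-1 < nth 0 a j)%R]) r]%N.

Lemma kidxP (a g : seq int) : (0 < size a)%N ->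
  let ok k := (0 < k <= size a)%N /\
    forall i, (k < i <= size a)%N -> nth 0 a i.-1 = nth 0 g i.-2 in
  ok (kidx a g : nat) /\ forall k, ok k -> (kidx a g <= k)%N.
Proof.
move=> a0 ok; rewrite /kidx; case: arg_minnP => [|k /andP[k0 /forallP kP] kmin].
  rewrite /= a0; apply/forallP => i; apply/implyP.
  by rewrite ltnNge -ltnS ltn_ord.
split.
  split=> [|i /andP[lt_ki le_ia]]; first by rewrite k0 -ltnS ltn_ord.
  apply/eqP; move: (kP (Ordinal (le_ia : (i < (size a).+1)%N))).
  by rewrite /= lt_ki.
move=> j [/andP[j0 le_ja] jP].
apply: (kmin (Ordinal (le_ja : (j < (size a).+1)%N))).
rewrite /= j0; apply/forallP => i; apply/implyP => /= lt_ji.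
by rewrite jP // lt_ji -ltnS ltn_ord.
Qed.

Lemma ridxP (a : seq int) (k : 'I_(size a).+1) :
  let ok r := (k <= r <= size a)%N /\
    forall j, (k <= j < r)%N -> nth 0 a j.-1 < nth 0 a j in
  ok (ridx k : nat) /\ forall r, ok r -> (r <= ridx k)%N.
Proof.
move=> ok; rewrite /ridx; case: arg_maxnP => [|r /andP[le_kr /forallP rP] rmax].
  rewrite leqnn; apply/forallP => j; apply/implyP => /andP[le_kj].
  by rewrite ltnNge le_kj.
split.
  split=> [|j /andP[le_kj lt_jr]]; first by rewrite le_kr -ltnS ltn_ord.
  have lt_ja : (j < (size a).+1)%N := ltn_trans lt_jr (ltn_ord r).
  by move: (rP (Ordinal lt_ja)); rewrite /= le_kj lt_jr.
move=> i [/andP[le_ki le_ia] iP].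
apply: (rmax (Ordinal (le_ia : (i < (size a).+1)%N))).
rewrite /= le_ki; apply/forallP => j; apply/implyP => /= kji.
exact: iP.
Qed.

Definition imm_coef (s : nat) (alpha gamma : composition) : rat :=
  let a := ints alpha in
  let g := ints gamma in
  if size g == size a then
    if Zcond s a (vsub a g) then sgnv (vsub a g) else 0
  else if (size g).+1 == size a then
    let k := kidx a g in
    let r := ridx k in
    let b := vsub (take k.-1 a) (take k.-1 g) in
    if ~~ odd (r - k)%N &&
       Zcond s a (b ++ nth 0 a k.-1 :: nseq (size a - k)%N 0)
    then sgnv b else 0
  else 0.

(* Main.v *)
(** Write [h_s] and [e_i] for the adjoints of [F_s] and [F_{1^i}].  Comparing
    coproducts, [h_{s+1} H_m = H_m h_{s+1} + h_s H_{m-1}] and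
    [e_{i+1} H_m = H_m e_{i+1} + H_{m-1} e_i]; hence [h_s] and [e_i] commute,
    [sum_i (-1)^i h_{n-i} e_i = 0] for [n > 0], and therefore
    [h_s B_a = sum_{i <= s} B_{a-s+i} h_i] and [H_m = sum_{i >= 0} B_{m+i} h_i].
    If [s >= a > 0] the first sum is the beginning of the second one for
    [m = a - s], where [H_{a-s}] is [1] or [0], so
    [h_s B_a = [s = a] - sum_{g > a} B_g h_{s-a+g}]: all indices are positive.
    Iterating on [B_{alpha_1} ... B_{alpha_m} (1)] gives a recursive coefficient
    whose full-length terms are described by (Z1)--(Z3); the terms stopped at
    the entries of an increasing run [alpha_k < ... < alpha_r] all have the same
    [gamma] and alternating signs, whence the parity of [r - k]. *)

From HB Require Import structures.
Require Import Defs.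
From mathcomp Require Import all_boot all_order all_algebra finmap.
From mathcomp Require Import monalg.
From mathcomp Require Import zify.

Import Order.TTheory GRing.Theory Num.Theory.
Local Open Scope ring_scope.

(** * The recursive coefficients *)

Lemma sum_triangle (V : nmodType) (f : nat -> nat -> V) N :
  \sum_(0 <= i < N) \sum_(0 <= k < N - i) f i k =
  \sum_(0 <= n < N) \sum_(0 <= i < n.+1) f i (n - i)%N.
Proof.
elim: N => [|N IH]; first by rewrite !big_geq.
rewrite [RHS]big_nat_recr //= -IH !big_nat_recr //= subSnn big_nat1 subnn.
rewrite addrA -big_split /=; congr (_ + _); apply: eq_big_nat => i lt_iN.
by rewrite subSn 1?ltnW // big_nat_recr.
Qed.

(** The coefficient of B_g h_{s+g-a} in h_s B_a for g > 0: the direct sum gives the range of g if s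
    < a, and the negated tail gives it if s >= a. *)
Definition step_coef (s a g : nat) : rat :=
  if (s < a)%N then (a - s <= g <= a)%N%:R else - (a < g)%N%:R.

(** The Kronecker term absorbs a and leaves the remaining factors untouched. The truncated
    [s + g - a] is exact wherever [step_coef] is nonzero. *)
Fixpoint perp_coeff (s : nat) (alpha gamma : seq nat) : rat :=
  if alpha is a :: alpha' then
    ((s == a) && (gamma == alpha'))%:R +
    (if gamma is g :: gamma' then
       step_coef s a g * perp_coeff (s + g - a)%N alpha' gamma' else 0)
  else ((s == 0%N) && (gamma == [::]))%:R.

(** A finite range for gamma, large enough once N is; shorter sequences occur because the recursion
    may stop early. *)
Fixpoint boxes (m N : nat) : seq (seq nat) :=
  if m is m'.+1 then
    [::] :: [seq g :: c | g <- index_iota 1 N, c <- boxes m' N]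
  else [:: [::]].

Lemma mem_boxes m N c :
  (c \in boxes m N) = (size c <= m)%N && all (fun g => 0 < g < N)%N c.
Proof.
elim: m c => [|m IH] [|g c] //=; rewrite in_cons /=.
apply/allpairsPdep/idP => [[h [d [hN dm [-> ->]]]]|].
  by rewrite mem_index_iota in hN; move: dm; rewrite IH ltnS hN.
case/andP=> sc /andP[hg ac]; exists g, c; split => //.
  by rewrite mem_index_iota.
by rewrite IH -ltnS sc.
Qed.

Lemma uniq_boxes m N : uniq (boxes m N).
Proof.
elim: m => //= m IH; apply/andP; split.
  by apply/allpairsPdep => -[? [? []]].
apply: allpairs_uniq_dep => [||[? ?] [? ?] _ _ /= [-> ->]] //.
exact: iota_uniq.
Qed.

(** A nonzero step passes from s to s + g - a, which keeps the sums balanced; only an early stop,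
    which happens at most once, drops a part. *)
Lemma perp_coeff_neq0 s (alpha gamma : seq nat) :
  all (ltn 0%N) alpha -> perp_coeff s alpha gamma != 0 ->
  [/\ all (ltn 0%N) gamma, (size gamma <= size alpha <= (size gamma).+1)%N
    & (sumn gamma + s = sumn alpha)%N].
Proof.
elim: alpha s gamma => [|a alpha IH] s gamma /=.
  by case: s gamma => [|s] [|g gamma]; rewrite ?andbF.
case/andP=> a0 apos.
have [/andP[/eqP-> /eqP->] _|_] := boolP ((s == a) && (gamma == alpha)).
  by rewrite apos leqnSn leqnn addnC.
rewrite add0r; case: gamma => [|g gamma]; first by rewrite eqxx.
rewrite mulf_eq0 negb_or => /andP[+ /IH[]//] => e0 gpos lesz sg.
move: e0; rewrite /step_coef /= gpos ltnS lesz; case: ltnP => [lt|le].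
  by rewrite pnatr_eq0 eqb0 negbK => ?; split=> //; lia.
by rewrite oppr_eq0 pnatr_eq0 eqb0 negbK => ?; split=> //; lia.
Qed.

(** * Conditions (Z1)-(Z3) *)

Definition Zstep (t a b : int) (rest : seq int) : bool :=
  [&& (a > t) ==> (0 <= b <= t),
      (a == t) ==> ((b == a) && all (pred1 0) rest) || (b < 0)
    & (a < t) ==> (b < 0)].

(** (Z2) is split off: it is automatic for the vectors that arise here from compositions, whereas
    (Z1) and (Z3) are checked entry by entry. *)
Definition Z13 (s : nat) (a b : seq int) : bool :=
  [&& size b == size a, Z1 s b & Z3 s a b].

Lemma ZcondE s a b : Zcond s a b = Z2 a b && Z13 s a b.
Proof.
by rewrite /Zcond /Z13; case: (size b == _); case: Z1; case: Z2; case: Z3.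
Qed.

Lemma Z1P s b : reflect (\sum_(x <- b) x = s%:Z /\
    forall i, (i < size b)%N -> \sum_(x <- take i b) x <= s%:Z) (Z1 s b).
Proof.
apply: (iffP andP) => -[sb le_b]; split; first exact/eqP; last 2 first.
- exact/eqP.
- by apply/forallP => i; apply/implyP => _; apply: le_b.
(* [Z1] omits the index 0, whose partial sum is empty; including it lets the condition shift along
   the list. *)
move=> i lt_ib; case: i lt_ib => [|i] lt_ib; first by rewrite take0 big_nil.
exact: (implyP (forallP le_b (Ordinal lt_ib))).
Qed.

Lemma Z3P s a b : reflect (forall i, (i < size a)%N ->
    Zstep (s%:Z - \sum_(x <- take i b) x) (nth 0 a i) (nth 0 b i) (drop i.+1 b))
  (Z3 s a b).
Proof.
apply: (iffP forallP) => [Zi i lt_ia|Zi i]; last exact: Zi.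
exact: (Zi (Ordinal lt_ia)).
Qed.

(** Removing b lowers s and the partial sums by b, so each t_i and each bound of (Z1) carries over
    to the tail. *)
Lemma Z13_cons (s s' : nat) a al b be : s%:Z = b + s'%:Z ->
  Z13 s (a :: al) (b :: be) = Zstep s a b be && Z13 s' al be.
Proof.
move=> sE; rewrite /Z13 /= eqSS; case: (size be == size al); rewrite ?andbF //=.
rewrite andbCA; congr (_ && _).
  apply/Z1P/Z1P => -[]; rewrite ?big_cons => sb le_b.
    split=> [|i lt_i]; first by apply: (addrI b); rewrite sb.
    by have := le_b i.+1 lt_i; rewrite /= big_cons sE lerD2l.
  split=> [|[|i] lt_i]; first by rewrite sb sE.
    by rewrite big_nil.
  by have := le_b i lt_i; rewrite /= big_cons sE lerD2l.
have tE i : s%:Z - \sum_(x <- take i.+1 (b :: be)) x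
    = s'%:Z - \sum_(x <- take i be) x.
  by rewrite /= big_cons sE opprD addrACA subrr add0r.
apply/Z3P/andP => [Zi|[Z0 /Z3P Zi] [|i] lt_i].
- split; first by have := Zi 0%N isT; rewrite /= big_nil subr0 drop0.
  by apply/Z3P => i lt_i; have := Zi i.+1 lt_i; rewrite tE.
- by rewrite /= big_nil subr0 drop0.
- by rewrite tE; apply: Zi.
Qed.

Definition step_ok (s a g : nat) : bool :=
  if (s < a)%N then (a - s <= g <= a)%N else (a < g)%N.

Lemma step_coefE s a g :
  step_coef s a g = if step_ok s a g then (-1) ^+ (a < g)%N else 0.
Proof.
rewrite /step_coef /step_ok; case: ltnP => _.
  by case: ifP => // /andP[_ le_ga]; rewrite ltnNge le_ga.
by case: (a < g)%N; rewrite ?oppr0.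
Qed.

(** As g > 0 excludes b = a in (Z3b), the first index requires 0 <= a - g <= s if s < a, and a - g <
    0 otherwise. *)
Lemma Z13_step s (a g : nat) al be : (0 < g)%N ->
  Z13 s (a%:Z :: al) (a%:Z - g%:Z :: be) =
  step_ok s a g && Z13 (s + g - a)%N al be.
Proof.
move=> g0; have [le_a|lt_a] := leqP a (s + g).
  rewrite (@Z13_cons s (s + g - a)); last by lia.
  congr (_ && _); rewrite /Zstep /step_ok.
  have -> : (a%:Z - g%:Z == a%:Z) = false by lia.
  by case: ltnP => ?; lia.
(* Here a - g > s, which violates (Z3a) as well as the range in [step_ok]. *)
have -> : step_ok s a g = false by rewrite /step_ok; case: ltnP => ?; lia.
apply/negbTE/negP => /and3P[_ _ /Z3P /(_ 0%N isT)].
by rewrite /= big_nil subr0 /Zstep; lia.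
Qed.

(** Every t_i is 0, so each positive entry falls under (Z3a), which admits 0. *)
Lemma Z13_zeros al : all (fun x => 0 < x) al -> Z13 0 al (nseq (size al) 0).
Proof.
elim: al => [_|a al IH /andP[a0 /IH Zal]].
  apply/and3P; split=> //; last by apply/Z3P.
  by apply/Z1P; rewrite big_nil.
by rewrite /= (@Z13_cons 0%N 0%N) // Zal andbT /Zstep; lia.
Qed.

Lemma Z13_end (a : nat) al : all (fun x => 0 < x) al ->
  Z13 a (a%:Z :: al) (a%:Z :: nseq (size al) 0).
Proof.
move=> /Z13_zeros Zal; rewrite (@Z13_cons a 0%N) ?addr0 // Zal andbT.
by rewrite /Zstep !ltxx !eqxx all_nseq /= orbT.
Qed.

Lemma sgnv_cons x b : sgnv (x :: b) = (-1) ^+ (x < 0)%R * sgnv b.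
Proof. by rewrite /sgnv /= exprD. Qed.

Local Notation toints := (map Posz).

(** Equal lengths rule out an early stop, so the coefficient is a product of [step_coef] values,
    whose signs count the negative differences. *)
Lemma perp_coeff_eq_size s (alpha gamma : seq nat) :
  size gamma = size alpha -> all (ltn 0%N) gamma ->
  let b := vsub (toints alpha) (toints gamma) in
  perp_coeff s alpha gamma = if Z13 s (toints alpha) b then sgnv b else 0.
Proof.
elim: alpha s gamma => [|a alpha IH] s [|g gamma] //=.
  rewrite andbT /Z13 /=; have -> : Z3 s [::] [::] by apply/Z3P.
  rewrite andbT; have -> : Z1 s [::] = (s == 0%N).
    apply/Z1P/eqP => [[]|->]; first by rewrite big_nil => -[].
    by rewrite big_nil.
  by case: eqP.
case=> sz /andP[g0 gpos]; have -> : (g :: gamma == alpha) = false.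
  by apply/eqP => ga; move: sz; rewrite -ga /=; lia.
rewrite andbF add0r.
rewrite -[vsub _ _]/(a%:Z - g%:Z :: vsub (toints alpha) (toints gamma)).
rewrite Z13_step // step_coefE IH //; case: step_ok; last by rewrite mul0r.
rewrite /=; case: Z13; last by rewrite mulr0.
by rewrite sgnv_cons subr_lt0 ltz_nat.
Qed.

(** * The indices k and r, and the terms of length one less *)

Fixpoint kpos (alpha gamma : seq nat) : nat :=
  if alpha is a :: alpha' then
    if gamma == alpha' then 0%N else (kpos alpha' (behead gamma)).+1
  else 0%N.

(** This is r - k for the list that starts at alpha_k. *)
Fixpoint run_length (alpha : seq nat) : nat :=
  if alpha is a :: alpha' then
    if alpha' is g :: _ then if (a < g)%N then (run_length alpha').+1 else 0%N
    else 0%N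
  else 0%N.

(** [kpos] is the first position at which the recursion of [perp_coeff] can stop; this identifies it
    with k - 1. *)
Lemma kposP (alpha gamma : seq nat) : (size gamma).+1 = size alpha ->
  let ok k := (k < size alpha)%N /\
    forall i, (k <= i)%N -> (i.+1 < size alpha)%N ->
      nth 0%N alpha i.+1 = nth 0%N gamma i in
  ok (kpos alpha gamma) /\ forall k, ok k -> (kpos alpha gamma <= k)%N.
Proof.
elim: alpha gamma => [|a alpha IH] gamma //= [sz].
have [->|neq] := eqVneq gamma alpha; first by split.
case: gamma sz neq => [|g gamma] sz neq.
  by case/eqP: neq; apply/esym/size0nil.
have [[lt_k eq_k] min_k] := IH gamma sz; split.
  split=> [|[|i] //]; first by [].
  by rewrite !ltnS; apply: eq_k.
case=> [[_ eq0]|k [lt_k' eq_k']].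
  case/eqP: neq; apply: (@eq_from_nth _ 0%N) => // i; rewrite sz => lt_i.
  by rewrite eq0.
rewrite ltnS; apply: min_k; split=> [//|i le_ki lt_i].
exact: (eq_k' i.+1).
Qed.

Lemma kidx_kpos (alpha gamma : seq nat) : (size gamma).+1 = size alpha ->
  kidx (toints alpha) (toints gamma) = (kpos alpha gamma).+1 :> nat.
Proof.
move=> sz; have [[lt_k eq_k] min_k] := kposP _ _ sz.
have [|[]] := @kidxP (toints alpha) (toints gamma); first by rewrite size_map -sz.
move: (nat_of_ord _) => K; rewrite size_map => lt_K eq_K min_K.
apply/eqP; rewrite eqn_leq; apply/andP; split.
  apply: min_K; split=> // -[|[|i]] // /andP[lt_i le_i].
  by rewrite !(nth_map 0%N) ?eq_k //; lia.
case: K lt_K eq_K {min_K} => [|k] // lt_K eq_K; rewrite ltnS.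
apply: min_k; split=> // i le_i lt_i.
have range_i : (k.+1 < i.+2 <= size alpha)%N by lia.
move: (eq_K _ range_i); rewrite /= (nth_map 0%N) // (nth_map 0%N); last by lia.
by case.
Qed.

Lemma run_lengthP (l : seq nat) : (0 < size l)%N ->
  [/\ (run_length l < size l)%N,
      forall j, (j < run_length l)%N -> (nth 0%N l j < nth 0%N l j.+1)%N
    & ((run_length l).+1 < size l)%N ->
      ~~ (nth 0%N l (run_length l) < nth 0%N l (run_length l).+1)%N].
Proof.
elim: l => [|a [|g l] IH] // _.
have [//|lt_r up_r max_r] := IH _.
rewrite -[run_length _]/(if (a < g)%N then (run_length (g :: l)).+1 else 0%N).
case: ifP => [lt_ag|/negbT nlt]; last by split.
by split=> // -[|j] //; apply: up_r.
Qed.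

(** The run is admissible for the maximum r, and a larger r would force an ascent right after its
    end. As k counts from 1, the run starts at [k.-1]. *)
Lemma ridx_run (alpha : seq nat) (k : 'I_(size (toints alpha)).+1) :
  (0 < k)%N -> ridx k = (k + run_length (drop k.-1 alpha))%N :> nat.
Proof.
move=> k0; have le_k : (k <= size alpha)%N by rewrite -(size_map Posz) -ltnS.
have := @ridxP _ k.
move: (nat_of_ord (ridx k)) (nat_of_ord k) k0 le_k => R K k0 le_k.
have [|lt_r up_r max_r] := run_lengthP (drop K.-1 alpha).
  by rewrite size_drop; lia.
rewrite size_drop in lt_r max_r.
rewrite size_map => -[[/andP[le_kR le_R] up_R] max_R].
have le_rR : (K + run_length (drop K.-1 alpha) <= R)%N.
  apply: max_R; split=> [|j /andP[le_kj lt_j]]; first by lia.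
  rewrite !(nth_map 0%N) ?ltz_nat; [|lia|lia].
  have := up_r (j - K)%N; rewrite !nth_drop.
  have -> : (K.-1 + (j - K) = j.-1)%N by lia.
  have -> : (K.-1 + (j - K).+1 = j)%N by lia.
  by apply; lia.
apply/eqP; rewrite eqn_leq le_rR andbT leqNgt; apply/negP => lt_R.
have := up_R (K + run_length (drop K.-1 alpha))%N.
rewrite leq_addr lt_R => /(_ isT); rewrite !(nth_map 0%N) ?ltz_nat; [|lia|lia].
apply/negP; move: max_r; rewrite !nth_drop.
have -> : (K.-1 + run_length (drop K.-1 alpha)
           = (K + run_length (drop K.-1 alpha)).-1)%N by lia.
have -> : (K.-1 + (run_length (drop K.-1 alpha)).+1
           = K + run_length (drop K.-1 alpha))%N by lia.
by apply; lia.
Qed.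

(* The terms obtained by stopping at a position of an increasing run of [alpha]
   all contribute to the same [gamma], with alternating signs. *)
Lemma perp_coeff_run a (alpha : seq nat) :
  perp_coeff a (a :: alpha) alpha = (~~ odd (run_length (a :: alpha)))%:R.
Proof.
elim: alpha a => [|g alpha IH] a; first by rewrite /= !eqxx addr0.
rewrite [LHS]/= -/(perp_coeff (a + g - a) (g :: alpha) alpha) addKn IH !eqxx.
rewrite -[run_length _ in RHS]/
  (if (a < g)%N then (run_length (g :: alpha)).+1 else 0%N).
(* Since s = a, going on past a has coefficient -1 if a < g and 0 otherwise; in the first case, 1
   minus the value for the tail flips the parity. *)
rewrite /step_coef ltnn; case: ltnP => _; last by rewrite oppr0 mul0r addr0.
by rewrite mulN1r /=; case: odd; rewrite ?subr0 ?subrr.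
Qed.

Definition stop_vec (kp : nat) (a g : seq int) : seq int :=
  vsub (take kp a) (take kp g) ++ nth 0 a kp :: nseq (size a - kp.+1)%N 0.

Lemma all_pos_toints (l : seq nat) :
  all (ltn 0%N) l -> all (fun x => 0 < x) (toints l).
Proof. by rewrite all_map; apply: sub_all. Qed.

(** Before [kpos] no stop is possible, so the steps behave as for equal lengths. At [kpos] the sums
    force s to be the current entry, and [perp_coeff_run] applies. *)
Lemma perp_coeff_pred_size s (alpha gamma : seq nat) :
  (size gamma).+1 = size alpha -> all (ltn 0%N) alpha -> all (ltn 0%N) gamma ->
  (sumn gamma + s = sumn alpha)%N ->
  let kp := kpos alpha gamma in
  perp_coeff s alpha gamma =
    if ~~ odd (run_length (drop kp alpha)) &&
       Z13 s (toints alpha) (stop_vec kp (toints alpha) (toints gamma))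
    then sgnv (vsub (take kp (toints alpha)) (take kp (toints gamma))) else 0.
Proof.
elim: alpha s gamma => [|a alpha IH] s gamma // [sz] /andP[a0 apos] gpos.
rewrite /kpos -/kpos; have [->|neq] := eqVneq gamma alpha => sE.
  have -> : s = a by move: sE; rewrite /=; lia.
  rewrite perp_coeff_run drop0 /stop_vec !take0 /= subSS subn0 Z13_end ?andbT //.
    by case: odd.
  exact: all_pos_toints.
case: gamma sz gpos neq sE => [|g gamma] sz.
  by move=> _ /eqP[]; apply/esym/size0nil.
case/andP=> g0 gpos neq sE; rewrite [LHS]/= (negbTE neq) andbF add0r.
rewrite [behead _]/= [drop _ _]/= [toints (_ :: _)]/= [toints (g :: _)]/=.
set kp := kpos alpha gamma.
have -> : stop_vec kp.+1 (Posz a :: toints alpha) (Posz g :: toints gamma) =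
    a%:Z - g%:Z :: stop_vec kp (toints alpha) (toints gamma).
  by rewrite /stop_vec /= subSS.
rewrite Z13_step // step_coefE.
case: (boolP (step_ok s a g)) => [ok|_]; last first.
  by rewrite mul0r /= andbF.
(* [step_ok] gives a <= s + g, so the sums for the tail balance without truncation. *)
rewrite IH //=; last by move: ok sE; rewrite /step_ok /=; case: ltnP; lia.
case: ifP => _; last by rewrite mulr0.
by rewrite -[vsub (_ :: _) _]/(_ - _ :: vsub _ _) sgnv_cons subr_lt0 ltz_nat.
Qed.

(** * Condition (Z2) and the comparison of the coefficients *)

Lemma vsub_cat a1 a2 b1 b2 : size a1 = size b1 ->
  vsub (a1 ++ a2) (b1 ++ b2) = vsub a1 b1 ++ vsub a2 b2.
Proof. by move=> sz; rewrite /vsub zip_cat // map_cat. Qed.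

Lemma size_vsub a b : size a = size b -> size (vsub a b) = size a.
Proof. by move=> sz; rewrite size_map size_zip sz minnn. Qed.

Lemma vsubK a g : size a = size g -> vsub a (vsub a g) = g.
Proof.
elim: a g => [|x a IH] [|y g] //= [sz].
by rewrite /vsub /= -!/(vsub _ _) IH // subKr.
Qed.

Lemma vsub0 a : vsub a (nseq (size a) 0) = a.
Proof. by elim: a => //= x a IH; rewrite /vsub /= -/(vsub _ _) IH subr0. Qed.

Lemma all_pos_nneg (l : seq int) :
  all (fun x => 0 < x) l -> all (fun x => 0 <= x) l /\ count (pred1 0) l = 0%N.
Proof.
move=> /allP lpos; split; first by apply/allP => x /lpos /ltW.
apply/eqP; rewrite -leqn0 leqNgt -has_count; apply/hasPn => x /lpos.
by rewrite /= lt0r => /andP[].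
Qed.

Lemma Z2_vsub (a g : seq int) :
  size a = size g -> all (fun x => 0 < x) g -> Z2 a (vsub a g).
Proof. by move=> sz /all_pos_nneg[nn c0]; rewrite /Z2 vsubK // nn c0. Qed.

(** The difference consists of entries of g, a single 0 at [kp], and entries of a, so exactly one
    entry vanishes. *)
Lemma Z2_stop_vec kp (a g : seq int) : (kp < size a)%N -> (kp <= size g)%N ->
  all (fun x => 0 < x) a -> all (fun x => 0 < x) g -> Z2 a (stop_vec kp a g).
Proof.
move=> lt_ka le_kg apos gpos.
have sz : size (take kp a) = size (take kp g).
  by rewrite !size_takel // ltnW.
have E : vsub a (stop_vec kp a g) = take kp g ++ 0 :: drop kp.+1 a.
  rewrite -{1}[a](cat_take_drop kp) (drop_nth 0) // /stop_vec.
  rewrite vsub_cat ?size_vsub // vsubK //.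
  rewrite -[vsub (_ :: _) _]/(_ - _ :: vsub _ _) subrr.
  by rewrite -(size_drop kp.+1 a) vsub0.
rewrite /Z2 E.
have [|nng cg] := all_pos_nneg (take kp g).
  by apply/allP => x /mem_take /(allP gpos).
have [|nna ca] := all_pos_nneg (drop kp.+1 a).
  by apply/allP => x /mem_drop /(allP apos).
by rewrite all_cat count_cat /= nng nna cg ca.
Qed.

Lemma imm_coefE s (alpha gamma : composition) :
  (sumn gamma + s = sumn alpha)%N ->
  imm_coef s alpha gamma = perp_coeff s alpha gamma.
Proof.
move=> sE; rewrite /imm_coef /ints.
have apos := comp_pos alpha; have gpos := comp_pos gamma.
have -> : (size (toints gamma) == size (toints alpha)) =
  (size gamma == size alpha) by rewrite !size_map.
have -> : ((size (toints gamma)).+1 == size (toints alpha)) =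
  ((size gamma).+1 == size alpha) by rewrite !size_map.
have [sz|nsz] := eqVneq (size gamma) (size alpha).
  rewrite perp_coeff_eq_size // ZcondE Z2_vsub ?size_map //.
  exact: all_pos_toints.
have [sz|nsz'] := eqVneq (size gamma).+1 (size alpha).
  have kE := kidx_kpos _ _ sz; have [[lt_k _] _] := kposP _ _ sz.
  rewrite perp_coeff_pred_size // ridx_run ?kE // addKn.
  rewrite -/(stop_vec (kpos alpha gamma) (toints alpha) (toints gamma)).
  by rewrite ZcondE Z2_stop_vec ?size_map ?all_pos_toints // -ltnS sz.
apply/esym/eqP; apply: contraT => /(perp_coeff_neq0 _ _ _ apos)[_ + _].
by move: nsz nsz'; lia.
Qed.

(** * Creation operators *)

Section CreationOperators.

(** Abstract model of NSym: [H m] is left multiplication by H_m, [h s] and [e i] are the adjoints of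
    F_s and F_{1^i}, and [deg] bounds the sum that defines [B]. *)
Variables (V : lmodType rat) (one : V).
Variables (H : int -> {linear V -> V}) (h e : nat -> {linear V -> V}).
Variables (B : int -> V -> V) (deg : V -> nat).

Hypothesis H0 : forall X, H 0 X = X.
Hypothesis H_lt0 : forall m X, m < 0 -> H m X = 0.
Hypothesis V_ind : forall P : V -> Prop,
  (forall X Y, P X -> P Y -> P (X + Y)) -> (forall c X, P X -> P (c *: X)) ->
  P one -> (forall (n : nat) X, P X -> P (H n X)) -> forall X, P X.
Hypothesis h0 : forall X, h 0%N X = X.
Hypothesis e0 : forall X, e 0%N X = X.
Hypothesis h_one : forall s, h s.+1 one = 0.
Hypothesis e_one : forall i, e i.+1 one = 0.
Hypothesis h_H : forall s m X,
  h s.+1 (H m X) = H m (h s.+1 X) + h s (H (m - 1) X).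
Hypothesis e_H : forall i m X,
  e i.+1 (H m X) = H m (e i.+1 X) + H (m - 1) (e i X).
Hypothesis deg_h : forall i X, (deg (h i X) <= deg X - i)%N.
Hypothesis BE : forall N m X, (deg X < N)%N ->
  B m X = \sum_(i < N) (-1) ^+ i *: H (m + i%:Z) (e i X).

(** By induction on X: on [H n X] the relations [h_H] and [e_H] expand both sides into the same four
    terms. *)
Lemma h_eC s i X : h s (e i X) = e i (h s X).
Proof.
case: s => [|s]; first by rewrite !h0.
case: i => [|i]; first by rewrite !e0.
elim/V_ind: X s i => [X Y HX HY|c X HX||n X HX] s i.
- by rewrite !linearD HX HY.
- by rewrite !linearZ /= HX.
- by rewrite h_one e_one !linear0.
have HX' t j : h t (e j X) = e j (h t X).
  by case: t j => [|t] [|j]; rewrite ?h0 ?e0.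
(* The inner induction treats e_{i+1} h_{s+1} H_{m-1}, so m must range over all integers. *)
move: (n : int) => m; elim: s m => [|s IH] m.
  rewrite e_H linearD /= !h_H !h0 linearD /= !e_H !HX'.
  exact: addrACA.
rewrite e_H linearD /= !(h_H s.+1) linearD /= -IH !e_H linearD /= !HX'.
exact: addrACA.
Qed.

(* The operator form of [sum_i (-1)^i h_(n-i) e_i = 0]: the left-hand side
   commutes with every [H m], so it suffices to evaluate it at [one]. *)
Lemma sum_h_e n X :
  \sum_(i < n.+2) (-1) ^+ i *: h (n.+1 - i)%N (e i X) = 0.
Proof.
elim/V_ind: X => [X Y HX HY|c X HX||k X HX].
- under eq_bigr do rewrite !linearD.
  by rewrite big_split /= HX HY addr0.
- under eq_bigr do rewrite !linearZ.
  by rewrite -scaler_sumr HX scaler0.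
- rewrite big_ord_recl big1 ?addr0 /= => [|i _].
    by rewrite e0 h_one scaler0.
  by rewrite /bump /= add1n e_one linear0 scaler0.
move: (k : int) => m.
(* The [a i] sum to [H m] of the induction hypothesis; the [b i] arise from [h_H] and, with opposite
   sign, from [e_H], and cancel. *)
pose a i := (-1) ^+ i *: H m (h (n.+1 - i)%N (e i X)).
pose b i := (-1) ^+ i *: h (n - i)%N (H (m - 1) (e i X)).
have a0 : \sum_(i < n.+2) a i = 0.
  have := congr1 (H m) HX; rewrite linear0 linear_sum /= => HX0.
  by rewrite -[RHS]HX0; apply: eq_bigr => i _; rewrite linearZ.
have step (i : 'I_n.+1) :
    (-1) ^+ i *: h (n.+1 - i)%N (H m (e i X)) = a i + b i.
  have := ltn_ord i; rewrite ltnS => le_in.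
  by rewrite subSn // h_H scalerDr /a subSn.
rewrite big_ord_recl /= e0 subn0 expr0 scale1r.
under eq_bigr => i _.
  rewrite /bump /= add1n subSS e_H linearD /= scalerDr
    [X in _ + X](_ : _ = - b i); last by rewrite exprS mulN1r scaleNr.
  over.
rewrite big_split /= addrA sumrN.
have -> : h n.+1 (H m X) +
      \sum_(i < n.+1) (-1) ^+ i.+1 *: h (n - i)%N (H m (e i.+1 X))
    = \sum_(i < n.+2) (-1) ^+ i *: h (n.+1 - i)%N (H m (e i X)).
  rewrite [RHS]big_ord_recl /= e0 subn0 expr0 scale1r.
  by [].
rewrite big_ord_recr /= subnn h0 (eq_bigr _ (fun i _ => step i)) big_split /=.
by rewrite -[RHS]a0 addrAC addrK [in RHS]big_ord_recr /= {3}/a subnn h0.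
Qed.

(** By [BE] one truncation bound serves all three vectors, and each term is linear. *)
Lemma B_add m X Y : B m (X + Y) = B m X + B m Y.
Proof.
pose N := (maxn (maxn (deg X) (deg Y)) (deg (X + Y))).+1.
rewrite !(@BE N) ?ltnS ?leq_max ?leqnn ?orbT // -big_split /=.
by apply: eq_bigr => i _; rewrite !linearD.
Qed.

Lemma B_scale m c X : B m (c *: X) = c *: B m X.
Proof.
pose N := (maxn (deg X) (deg (c *: X))).+1.
rewrite !(@BE N) ?ltnS ?leq_max ?leqnn ?orbT // scaler_sumr.
by apply: eq_bigr => i _; rewrite !linearZ /= !scalerA mulrC.
Qed.

Lemma B_sum m I (r : seq I) (P : pred I) (X : I -> V) :
  B m (\sum_(i <- r | P i) X i) = \sum_(i <- r | P i) B m (X i).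
Proof.
apply: (big_morph (B m) (B_add m)).
by rewrite -[in LHS](scale0r (0 : V)) B_scale scale0r.
Qed.

(** Since h commutes with each e_i, the relation [h_H] passes to [B] term by term. *)
Lemma h_B s m X : h s.+1 (B m X) = B m (h s.+1 X) + h s (B (m - 1) X).
Proof.
pose N := (maxn (deg X) (deg (h s.+1 X))).+1.
rewrite !(@BE N) ?ltnS ?leq_max ?leqnn ?orbT // !linear_sum -big_split /=.
apply: eq_bigr => i _; rewrite !linearZ -scalerDr h_H h_eC.
by rewrite addrAC.
Qed.

Lemma h_B_sum s m X :
  h s (B m X) = \sum_(0 <= i < s.+1) B (m - s%:Z + i%:Z) (h i X).
Proof.
elim: s m => [|s IH] m; first by rewrite big_nat1 !h0 subr0 addr0.
rewrite h_B IH [RHS]big_nat_recr //= addrC subrK; congr (_ + _).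
by apply: eq_big_nat => i _; congr B; lia.
Qed.

(** Once each B is expanded, H_{m+n} is applied to the alternating sum of the h_{n-i} e_i, which
    vanishes for n > 0. *)
Lemma H_B_sum N m X : (deg X < N)%N ->
  H m X = \sum_(0 <= i < N) B (m + i%:Z) (h i X).
Proof.
move=> lt_XN.
transitivity (\sum_(0 <= i < N) \sum_(0 <= k < N - i)
    (-1) ^+ k *: (H (m + (i + k)%N%:Z) (e k (h i X)))); last first.
  (* The bound N - i suffices because h_i lowers the degree by i; it makes the double sum
     triangular. *)
  apply: eq_big_nat => i lt_iN; rewrite (@BE (N - i)); last first.
    by have := deg_h i X; lia.
  by rewrite big_mkord; apply: eq_bigr => k _; rewrite -addrA PoszD.
rewrite sum_triangle (eq_big_nat _ _ (F2 := fun n => H (m + n%:Z)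
    (\sum_(i < n.+1) (-1) ^+ i *: h (n - i)%N (e i X)))); last first.
  move=> n _; rewrite big_mkord (reindex_inj rev_ord_inj) /= linear_sum.
  apply: eq_bigr => i _; rewrite subSS linearZ /= h_eC subKn -1?ltnS //.
  by rewrite subnK -1?ltnS.
case: N lt_XN => // N _.
rewrite big_nat_recl // big_ord1 e0 h0 expr0 scale1r addr0.
by rewrite big1 ?addr0 // => n _; rewrite sum_h_e linear0.
Qed.

(* For [a <= s] the sum [h_B_sum] is the initial part of [H_B_sum] at
   [m = a - s], which is replaced by the negative of the remaining part. *)
Lemma h_B_pos N s a X : (0 < a)%N -> (deg X + a < N)%N ->
  h s (B a X) = (s == a)%:R *: X +
    \sum_(1 <= g < N) step_coef s a g *: B g (h (s + g - a)%N X).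
Proof.
move=> a0 ltN; rewrite h_B_sum /step_coef.
have [lt_sa|le_as] := ltnP s a.
  rewrite ltn_eqF // scale0r add0r.
  rewrite [RHS](big_cat_nat (n := (a - s)%N)) /=; [|lia|lia].
  rewrite [X in _ = X + _]big_nat
    [X in _ = X + _]big1 ?add0r => [|g lt_g]; last first.
    by rewrite (_ : (a - s <= g <= a)%N = false) ?scale0r //; lia.
  rewrite [RHS](big_cat_nat (n := a.+1)) /=; [|lia|lia].
  rewrite [X in _ = _ + X]big_nat
    [X in _ = _ + X]big1 ?addr0 => [|g lt_g]; last first.
    by rewrite (_ : (a - s <= g <= a)%N = false) ?scale0r //; lia.
  rewrite -{1}[(a - s)%N]add0n big_addn.
  have -> : (a.+1 - (a - s) = s.+1)%N by lia.
  apply: eq_big_nat => i lt_i.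
  have -> : (a - s <= i + (a - s) <= a)%N by lia.
  rewrite scale1r; have -> : (s + (i + (a - s)) - a = i)%N by lia.
  by congr B; lia.
have -> : (s == a)%:R *: X = H (a%:Z - s%:Z) X.
  have [->|neq] := eqVneq s a; first by rewrite subrr H0 scale1r.
  by rewrite H_lt0 ?scale0r //; lia.
(* With this bound the tail i > s, reindexed by g = i - (s - a), runs over a < g < N. *)
rewrite (@H_B_sum (N + s - a)); last by lia.
rewrite (big_cat_nat (n := s.+1) (p := (N + s - a)%N)) //=; last by lia.
rewrite -[LHS]addr0 -addrA; congr (_ + _).
rewrite [X in _ = _ + X](big_cat_nat (n := a.+1)) /=; [|lia|lia].
rewrite [X in _ = _ + (X + _)]big_nat
  [X in _ = _ + (X + _)]big1 ?add0r => [|g lt_g];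
  last by rewrite (_ : (a < g)%N = false) ?oppr0 ?scale0r //; lia.
have -> : s.+1 = (a.+1 + (s - a))%N by lia.
rewrite big_addn.
have -> : (N + s - a - (s - a) = N)%N by lia.
rewrite -big_split /= big_nat big1 // => g lt_g.
have -> : (a < g)%N by lia.
rewrite scaleN1r; have -> : (s + g - a = g + (s - a))%N by lia.
have -> : a%:Z - s%:Z + (g + (s - a))%N%:Z = g%:Z by lia.
by rewrite subrr.
Qed.

Let imm (a : seq nat) : V := foldr B one [seq Posz i | i <- a].

Lemma h_foldr_B (alpha : seq nat) : all (ltn 0%N) alpha ->
  exists N0, forall N s, (N0 <= N)%N ->
  h s (imm alpha) =
    \sum_(c <- boxes (size alpha) N) perp_coeff s alpha c *: imm c.
Proof.
elim: alpha => [_|a alpha IH /andP[a0 /[dup] apos /IH[N0 HN0]]].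
  exists 0%N => N s _; rewrite /= big_seq1 /= andbT.
  by case: s => [|s]; rewrite ?h0 ?scale1r // h_one scale0r.
(* The three bounds serve the tail's expansion, the membership of [alpha] itself in the box, and
   [h_B_pos]. *)
exists (maxn N0 (maxn (sumn alpha) (deg (imm alpha) + a)).+1).
move=> N s; rewrite geq_max gtn_max => /and3P[leN0 ltsN ltaN].
rewrite [imm _]/= -/(imm _) (@h_B_pos N) //.
under [RHS]eq_bigr => c _ do rewrite [perp_coeff _ _ _]/= scalerDl.
rewrite big_split /=; congr (_ + _).
  rewrite -[_ :: _]/(boxes (size alpha).+1 N) (bigD1_seq alpha) ?uniq_boxes //.
    rewrite /= eqxx andbT big1 ?addr0 // => c /negbTE->.
    by rewrite andbF scale0r.
  rewrite mem_boxes leqnSn /=; apply/allP => x xa.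
  apply/andP; split; first exact: (allP apos).
  apply: leq_ltn_trans ltsN.
  by elim: (alpha) xa => //= y al IHal; rewrite inE => /orP[/eqP->|/IHal]; lia.
rewrite big_cons scale0r add0r big_allpairs_dep /=.
apply: eq_bigr => g _; rewrite (HN0 N) // B_sum scaler_sumr.
by apply: eq_bigr => c _; rewrite B_scale scalerA.
Qed.

End CreationOperators.

(** * Adjoint operators on NSym *)

Local Arguments Hgen : simpl never.

Lemma Hgen0 : Hgen 0 = 1.
Proof. by []. Qed.

Lemma Hgen_lt0 m : m < 0 -> Hgen m = 0.
Proof. by case: m. Qed.

Lemma NSym_sumE (X : NSym) : X = \sum_(a <- msupp X) X@_a *: << a >>.
Proof.
rewrite {1}[X]monalgE; apply: eq_bigr => a _.
by apply/malgP => k; rewrite mcoeffZ !mcoeffU mulrnAr mulr1.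
Qed.

Lemma pairingZl (c : rat) (X : NSym) g : pairing (c *: X) g = c * pairing X g.
Proof.
rewrite {1}[X]NSym_sumE scaler_sumr pairing_suml [in RHS]/pairing mulr_sumr.
by apply: eq_bigr => a _; rewrite scalerA pairing_ZU mulrA.
Qed.

(** Scalars act through the constants [c%:MP], supported at the empty composition and hence
    central. *)
Lemma NSym_scalerAr (c : rat) (X Y : NSym) : c *: (X * Y) = X * (c *: Y).
Proof.
have comm : c%:MP * X = X * c%:MP :> NSym.
  rewrite !malgM_def fgmulUg fgmulgU; apply: eq_bigr => k _.
  by rewrite mulrC mul1m mulm1.
by rewrite -!mul_malgC [LHS]mulrA comm mulrA.
Qed.

Definition Hmul (m : int) (X : NSym) : NSym := Hgen m * X.

Lemma Hmul_is_linear m : linear (Hmul m).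
Proof. by move=> c X Y; rewrite /Hmul mulrDr NSym_scalerAr. Qed.

HB.instance Definition _ m :=
  GRing.isLinear.Build rat NSym NSym *:%R (Hmul m) (Hmul_is_linear m).

Lemma perp_coef F X b : (perp F X)@_b = pairing X (qmul F (Mqs b)).
Proof. by rewrite -pairing_M perpP. Qed.

Lemma perp_is_linear F : linear (perp F).
Proof.
move=> c X Y; apply/malgP => b.
by rewrite mcoeffD mcoeffZ !perp_coef pairing_addl pairingZl.
Qed.

HB.instance Definition _ F :=
  GRing.isLinear.Build rat NSym NSym *:%R (perp F) (perp_is_linear F).

(** This is the coproduct H_n -> sum_j H_j (x) H_{n-j} in coordinates; zero entries are kept in the
    splits and removed by [pack]. *)
Lemma perp_pack F e :
  perp F << pack e >> = \sum_(p <- splits e) F p.1 *: (<< pack p.2 >> : NSym).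
Proof.
apply/malgP => b; rewrite perp_coef -[X in pairing X _]scale1r pairing_ZU mul1r.
rewrite -qcoef_pack /= /ps_mul raddf_sum /=; apply: eq_bigr => p _.
by rewrite mcoeffZ mcoeffU1.
Qed.

Lemma perp_pack_cons F n e :
  perp F << pack (n :: e) >> = \sum_(j <- iota 0 n.+1) \sum_(p <- splits e)
     F (j :: p.1) *: (<< pack ((n - j)%N :: p.2) >> : NSym).
Proof. by rewrite perp_pack big_allpairs_dep. Qed.

Lemma Hmul_pack (n : nat) e : Hmul n << pack e >> = << pack (n :: e) >>.
Proof.
rewrite /Hmul !Hgen_comp; case: n => [|n] /=; first by rewrite Hgen0 mul1r.
by rewrite big_cons.
Qed.

Lemma NSym_linear_ext (f g : {linear NSym -> NSym}) :
  (forall e, f << pack e >> = g << pack e >>) -> f =1 g.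
Proof.
move=> fg X; rewrite [X]NSym_sumE !linear_sum; apply: eq_bigr => a _.
by rewrite !linearZ /= -[a]packK fg.
Qed.

Lemma NSym_ind (P : NSym -> Prop) :
  (forall X Y, P X -> P Y -> P (X + Y)) -> (forall c X, P X -> P (c *: X)) ->
  P 1 -> (forall (n : nat) X, P X -> P (Hmul n X)) -> forall X, P X.
Proof.
move=> PD PZ P1 PH X; have P0 : P 0 by rewrite -(scale0r 1); apply: PZ.
rewrite [X]NSym_sumE; elim/big_ind: _ => // a _.
apply: PZ; rewrite Hgen_comp; elim: (parts a) => [|n s IH].
  by rewrite big_nil.
by rewrite big_cons; apply: PH.
Qed.

(** * The adjoints of F_s and F_{1^i} *)

Local Notation hperp s := (perp (Fqs (pack [:: s]))).
Local Notation eperp i := (perp (Fqs (pack (nseq i 1%N)))).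

Lemma Fqs_coef (a : composition) e :
  Fqs a e = ((sumn e == sumn a) && refines (pack e) a)%:R.
Proof.
have [ses|nes] := eqVneq; last by rewrite Fqs_homog.
rewrite FqsE big_mkcond (bigD1_seq (pack e)) ?uniq_comps //=; last first.
  by rewrite mem_comps sumn_pack ses.
rewrite /Mcoef eqxx big1 ?addr0 => [|b]; first by case: ifP.
by rewrite eq_sym => /negbTE->; rewrite if_same.
Qed.

(** Every composition of s refines [s], so F_s is the complete homogeneous function. *)
Lemma Fqs_row s e : Fqs (pack [:: s]) e = (sumn e == s)%:R.
Proof.
rewrite Fqs_coef sumn_pack /= addn0; case: eqP => // ses.
suff -> : refines (pack e) (pack [:: s]) by [].
(* For s = 0 the composition is empty, and so is its list of blocks. *)
apply/refinesP; case: s ses => [|s] ses.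
  exists [::]; split=> //=; apply/esym/nilP; rewrite /nilp size_filter.
  by move: ses; elim: e => //= -[].
exists [:: parts (pack e)]; split;
  last by rewrite /= -/(parts (pack e)) sumn_pack ses.
  by rewrite inE eq_sym; apply/eqP => e0; move: (sumn_pack e); rewrite e0 ses.
by rewrite /= cats0.
Qed.

Lemma pack_nseq1 i : parts (pack (nseq i 1%N)) = nseq i 1%N.
Proof. by elim: i => //= i ->. Qed.

(** A block of positive parts with sum 1 is a single 1, so 1^i has no proper refinement and F_{1^i}
    is elementary. *)
Lemma Fqs_col i e :
  Fqs (pack (nseq i 1%N)) e = (pack e == pack (nseq i 1%N))%:R.
Proof.
rewrite Fqs_coef sumn_pack -[sumn e]sumn_pack; congr (nat_of_bool _)%:R.
apply/andP/eqP => [[_ /refinesP[bs []]]|->]; last first.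
  split; first by rewrite sumn_pack.
  apply/refinesP; exists (nseq i [:: 1%N]).
  by rewrite pack_nseq1; split; elim: i => //= i ->.
move=> nbs fbs sbs; apply/val_inj.
rewrite -[LHS]/(parts _) -[RHS]/(parts _).
move: (comp_pos (pack e)) nbs sbs; rewrite -fbs pack_nseq1.
elim: bs i {fbs} => [|c bs IH] [|i] //=; rewrite all_cat inE.
case/andP=> cpos bpos /norP[nc nb] [sc sbs]; rewrite (IH i) //.
by case: c cpos sc nc => [|[|[|x]] [|[|y] c]].
Qed.

Lemma hperp0 X : hperp 0%N X = X.
Proof.
apply: (@NSym_linear_ext (perp _) idfun) => e /=.
rewrite perp_pack; elim: e => [|n e IH].
  by rewrite big_seq1 Fqs_row scale1r.
rewrite -perp_pack perp_pack_cons big_cons [X in _ + X]big1_seq ?addr0 => [|i].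
  rewrite -[RHS]Hmul_pack -[in RHS]IH [RHS]linear_sum; apply: eq_bigr => p _ /=.
  by rewrite linearZ /= Hmul_pack subn0 !Fqs_row.
rewrite mem_iota => /andP[_ /andP[i0 _]]; rewrite big1 // => p _.
by rewrite Fqs_row /= addn_eq0; case: i i0 => //= i _; rewrite scale0r.
Qed.

Lemma eperp0 X : eperp 0%N X = X.
Proof.
have -> : pack (nseq 0 1%N) = pack [:: 0%N] by apply/val_inj.
exact: hperp0.
Qed.

Lemma pack_nil : (<< pack [::] >> : NSym) = 1.
Proof. by rewrite Hgen_comp big_nil. Qed.

Lemma hperp1 s : hperp s.+1 1 = 0.
Proof. by rewrite -pack_nil perp_pack big_seq1 Fqs_row scale0r. Qed.

Lemma eperp1 i : eperp i.+1 1 = 0.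
Proof. by rewrite -pack_nil perp_pack big_seq1 Fqs_col scale0r. Qed.

Lemma Hmul0 X : Hmul 0 X = X.
Proof. exact: mul1r. Qed.

Lemma Hmul_lt0 m X : m < 0 -> Hmul m X = 0.
Proof. by move=> m0; rewrite /Hmul Hgen_lt0 // mul0r. Qed.

(** In the splits of the first entry, j = 0 gives the first term; for j > 0, lowering j, the entry
    and s by one gives the second. *)
Lemma hperp_Hmul s m X :
  hperp s.+1 (Hmul m X) = Hmul m (hperp s.+1 X) + hperp s (Hmul (m - 1) X).
Proof.
case: m => [[|n]|n].
- by rewrite !Hmul0 Hmul_lt0 // linear0 addr0.
- have -> : Posz n.+1 - 1 = Posz n by lia.
  apply: (@NSym_linear_ext (hperp s.+1 \o Hmul n.+1)
    ((Hmul n.+1 \o hperp s.+1) \+ (hperp s \o Hmul n))) => e /=.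
  rewrite !Hmul_pack perp_pack_cons -[iota 0 n.+2]/(0%N :: iota (1 + 0) n.+1).
  rewrite big_cons iotaDl big_map perp_pack perp_pack_cons linear_sum.
  congr (_ + _); apply: eq_bigr => i _.
    by rewrite linearZ /= Hmul_pack subn0 !Fqs_row.
  by apply: eq_bigr => p _; rewrite !Fqs_row /= add1n addSn eqSS subSS.
- by rewrite !(@Hmul_lt0 (Negz n)) // [Hmul _ X]Hmul_lt0 ?linear0 ?addr0.
Qed.

(** Only exponents 0 and 1 occur in F_{1^i}; they give the two terms. *)
Lemma eperp_Hmul i m X :
  eperp i.+1 (Hmul m X) = Hmul m (eperp i.+1 X) + Hmul (m - 1) (eperp i X).
Proof.
case: m => [[|n]|n].
- by rewrite !Hmul0 Hmul_lt0 // addr0.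
- have -> : Posz n.+1 - 1 = Posz n by lia.
  apply: (@NSym_linear_ext (eperp i.+1 \o Hmul n.+1)
    ((Hmul n.+1 \o eperp i.+1) \+ (Hmul n \o eperp i))) => e.
  rewrite -[LHS]/(eperp i.+1 (Hmul n.+1 _)).
  rewrite -[RHS]/(Hmul n.+1 (eperp i.+1 _) + Hmul n (eperp i _)).
  rewrite Hmul_pack perp_pack_cons -[iota 0 n.+2]/[:: 0, 1 & iota 2 n]%N.
  rewrite !big_cons [X in _ + (_ + X)]big1_seq ?addr0 => [|j].
    rewrite !perp_pack !linear_sum; congr (_ + _); apply: eq_bigr => p _.
      by rewrite !Fqs_col linearZ /= Hmul_pack subn0.
    by rewrite !Fqs_col -!val_eqE linearZ /= Hmul_pack subn1.
  rewrite mem_iota => /andP[_ /andP[j0 _]]; rewrite big1 // => p _.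
  rewrite Fqs_col -val_eqE /=.
  by case: j j0 => [|[|j]] //= _; rewrite scale0r.
- by rewrite !(@Hmul_lt0 (Negz n)) // [Hmul _ (perp _ _)]Hmul_lt0 ?linear0 ?addr0.
Qed.

(** * Degree bounds and the expansion over compositions *)

Lemma hdeg_leP (X : NSym) (d : nat) :
  (forall b : composition, (d < sumn b)%N -> X@_b = 0) -> (hdeg X <= d)%N.
Proof.
move=> Xd; rewrite /hdeg big_seq; elim/big_ind: _ => //.
  by move=> x y; rewrite geq_max => -> ->.
move=> b; rewrite leqNgt -mcoeff_neq0; apply: contra => /Xd ->.
by rewrite eqxx.
Qed.

Lemma hdeg_perp_Fqs (a : composition) X :
  (hdeg (perp (Fqs a) X) <= hdeg X - sumn a)%N.
Proof.
apply: hdeg_leP => b lt_b; rewrite perp_coef /pairing big_seq big1 // => c.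
move=> /hdeg_le le_c.
rewrite /= /ps_mul big_seq big1 ?mulr0 // => p /sumn_splits sp.
have [sa|na] := eqVneq (sumn p.1) (sumn a); last by rewrite Fqs_homog ?mul0r.
rewrite /Mcoef; case: eqP => [eb|_]; last by rewrite mulr0.
by have := sumn_pack p.2; rewrite eb; lia.
Qed.

Lemma hdeg_hperp s X : (hdeg (hperp s X) <= hdeg X - s)%N.
Proof. by have := hdeg_perp_Fqs (pack [:: s]) X; rewrite sumn_pack /= addn0. Qed.

Lemma hperp_immaculate_comps s (alpha : composition) :
  hperp s (immaculate (ints alpha)) =
    \sum_(gamma <- compsz ((sumn alpha)%:Z - s%:Z))
      perp_coeff s alpha gamma *: immaculate (ints gamma).
Proof.
have [N0 HN0] := @h_foldr_B NSym 1 Hmul (fun s => hperp s) (fun i => eperp i)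
  Bop hdeg Hmul0 Hmul_lt0 NSym_ind hperp0 eperp0 hperp1 eperp1 hperp_Hmul
  eperp_Hmul hdeg_hperp BopE alpha (comp_pos alpha).
(* Parts of a contributing gamma are at most the sum of alpha, so the box and the compositions carry
   the same nonzero terms. *)
pose N := (maxn N0 (sumn alpha).+1).
pose F c := perp_coeff s alpha c *: immaculate [seq Posz i | i <- c].
transitivity (\sum_(c <- boxes (size alpha) N) F c).
  by apply: HN0; rewrite leq_maxl.
rewrite -[RHS](big_map parts predT F).
rewrite [LHS](bigID (fun c => perp_coeff s alpha c == 0)) big1 ?add0r; last first.
  by move=> c /eqP c0; rewrite /F c0 scale0r.
rewrite [RHS](bigID (fun c => perp_coeff s alpha c == 0)) [X in _ = X + _]big1
  ?add0r; last by move=> c /eqP c0; rewrite /F c0 scale0r.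
rewrite /= ?add0r -big_filter -[RHS]big_filter; apply: perm_big; apply: uniq_perm.
- by rewrite filter_uniq ?uniq_boxes.
- rewrite filter_uniq // map_inj_uniq; last exact: val_inj.
  by rewrite /compsz; case: (_ - _) => // n; apply: uniq_comps.
move=> c; rewrite !mem_filter mem_boxes; case: eqP => //= /eqP c0.
have [cpos /andP[csz _] csum] := perp_coeff_neq0 _ _ _ (comp_pos alpha) c0.
rewrite csz; transitivity true; last first.
  symmetry; apply/mapP; exists (Composition cpos) => //.
  by rewrite mem_compsz /=; apply/eqP; lia.
apply/allP => x xc /=; apply/andP; split; first exact: (allP cpos).
have : (x <= sumn c)%N.
  elim: (c) xc => //= y al IHal; rewrite inE => /orP[/eqP->|/IHal]; lia.
by rewrite /N; lia.
Qed.

Lemma sgnv_mem b : sgnv b \in [:: -1; 0; 1].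
Proof. by rewrite /sgnv -signr_odd; case: odd. Qed.

Theorem theorem4p4 (s : nat) (hs : (0 < s)%N) (alpha : composition) :
  [/\ perp (Fqs (pack [:: s])) (immaculate (ints alpha)) =
        \sum_(gamma <- compsz ((sumn alpha)%:Z - s%:Z))
          imm_coef s alpha gamma *: immaculate (ints gamma),
      forall gamma : composition, imm_coef s alpha gamma \in [:: -1; 0; 1]
    & forall gamma : composition,
        size gamma != size alpha -> (size gamma).+1 != size alpha ->
        imm_coef s alpha gamma = 0].
Proof.
split=> [|gamma|gamma nsz nsz'].
- rewrite hperp_immaculate_comps; apply: eq_big_seq => gamma.
  by rewrite mem_compsz => /eqP sE; rewrite imm_coefE //; lia.
- by rewrite /imm_coef; do ![case: ifP => _] => //; apply: sgnv_mem.
- by rewrite /imm_coef !ifN // !size_map.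
Qed.
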